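(* Miller forcing $\mathbb M$ forces that every two unbounded sequences $b,c$ belonging to the ground model are locked.
   Context: An unbounded sequence is an $\omega_1$-sequence of increasing functions in $\omega^\omega$, increasing in the modulo-finite (eventual domination) ordering, with no upper bound in the eventual domination ordering. Unbounded sequences $b,c$ are locked if there is an infinite set $x\subseteq\omega$ such that for every $\alpha\in\omega_1$ there is $\beta\in\omega_1$ with $b(\beta)\restriction x$ eventually dominating $c(\alpha)\restriction x$, and for every $\alpha\in\omega_1$ there is $\beta\in\omega_1$ with $c(\beta)\restriction x$ eventually dominating $b(\alpha)\restriction x$. Miller forcing $\mathbb M$ is the set of nonempty trees $T\subseteq\omega^{<\omega}$ consisting of increasing sequences such that every $t\in T$ has an extension in $T$ which is a splitnode of $T$, and every splitnode of $T$ has infinitely many immediate successors in $T$; it is ordered by inclusion. *)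

(* Defs.v *)
From mathcomp Require Import all_boot.
From mathcomp Require Import boolp classical_sets cardinality.
Set Implicit Arguments.
Unset Strict Implicit.
Unset Printing Implicit Defensive.

Local Open Scope classical_set_scope.

(* The ground model is the ambient universe: omega is [nat], omega^omega is
   [nat -> nat], and omega_1 is any well-ordered type of order type omega_1,
   i.e. an uncountable well-order all of whose proper initial segments are
   countable (this determines it up to isomorphism). *)
Record is_omega1 (W : Type) (lt : W -> W -> Prop) : Prop := IsOmega1 {
  omega1_trans : forall a b c, lt a b -> lt b c -> lt a c;
  omega1_total : forall a b, lt a b \/ a = b \/ lt b a;
  omega1_wf : well_founded lt;
  omega1_uncountable : ~ countable [set: W];
  omega1_segments : forall a, countable [set b | lt b a]
}.

(* the dominating function comes first *)
Definition dominates (f g : nat -> nat) : Prop :=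
  exists n, forall m, n <= m -> g m <= f m.

(* Both monotonicity requirements are weak, so that sequences satisfying the
   strict variants are included. *)
Record unbounded_sequence (W : Type) (lt : W -> W -> Prop)
    (b : W -> nat -> nat) : Prop := UnboundedSequence {
  unbounded_increasing : forall a m n, m <= n -> b a m <= b a n;
  unbounded_modfin : forall a a', lt a a' -> dominates (b a') (b a);
  unbounded_nobound : ~ exists g, forall a, dominates g (b a)
}.

Record forcing_notion := ForcingNotion {
  condition :> Type;
  stronger : condition -> condition -> Prop;
  stronger_refl : forall p, stronger p p;
  stronger_trans : forall p q r, stronger p q -> stronger q r -> stronger p r
}.

Definition dense_below (P : forcing_notion) (p : P) (D : set P) : Prop :=
  forall q, stronger q p -> exists2 r, stronger r q & D r.

(* A name for a subset of omega: a set of pairs (check n, p).  Every subset of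
   omega in the generic extension has a name of this form. *)
Definition real_name (P : forcing_notion) := nat -> set P.

(* Formulas of the forcing language.  [Ground Q] is a statement about the
   ground model.  Quantifiers range over a type A: if A is a ground-model set
   this is bounded quantification over its check name; if A is [real_name P]
   this is quantification over all subsets of omega in the extension. *)
Inductive formula (P : forcing_notion) : Type :=
| Ground of Prop
| Member of nat & real_name P
| Not of formula P
| And of formula P & formula P
| Imp of formula P & formula P
| All (A : Type) of (A -> formula P)
| Ex (A : Type) of (A -> formula P).

Arguments Ground {P} _.
Arguments Member {P} _ _.
Arguments Not {P} _.
Arguments And {P} _ _.
Arguments Imp {P} _ _.
Arguments All {P A} _.
Arguments Ex {P A} _.

(* In the clause for [Imp], a formula forced densely below q is forced by q, so
   this agrees with "no q <= p forces both phi1 and not phi2". *)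
Fixpoint forces (P : forcing_notion) (p : P) (phi : formula P) : Prop :=
  match phi with
  | Ground Q => Q
  | Member n x => dense_below p [set q | exists2 r, x n r & stronger q r]
  | Not phi1 => forall q, stronger q p -> ~ forces q phi1
  | And phi1 phi2 => forces p phi1 /\ forces p phi2
  | Imp phi1 phi2 => forall q, stronger q p -> forces q phi1 -> forces q phi2
  | All A phi1 => forall a : A, forces p (phi1 a)
  | Ex A phi1 => dense_below p [set q | exists a : A, forces q (phi1 a)]
  end.

Definition notion_forces (P : forcing_notion) (phi : formula P) : Prop :=
  forall p : P, forces p phi.

Definition infinite_formula (P : forcing_notion) (x : real_name P) :
    formula P :=
  All (fun k : nat => Ex (fun m : nat => And (Ground (k <= m)) (Member m x))).

(* the restriction of f to x eventually dominates the restriction of g to x *)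
Definition dominates_on_formula (P : forcing_notion) (x : real_name P)
    (f g : nat -> nat) : formula P :=
  Ex (fun n : nat => All (fun m : nat =>
    Imp (And (Ground (n <= m)) (Member m x)) (Ground (g m <= f m)))).

Definition locked_formula (P : forcing_notion) (W : Type)
    (b c : W -> nat -> nat) : formula P :=
  Ex (fun x : real_name P =>
    And (infinite_formula x)
   (And (All (fun a : W => Ex (fun a' : W =>
           dominates_on_formula x (b a') (c a))))
        (All (fun a : W => Ex (fun a' : W =>
           dominates_on_formula x (c a') (b a)))))).

Definition successors (T : set (seq nat)) (t : seq nat) : set nat :=
  [set n | T (rcons t n)].

Definition splitnode (T : set (seq nat)) (t : seq nat) : Prop :=
  T t /\ exists m n, [/\ m <> n, successors T t m & successors T t n].

Record is_miller_tree (T : set (seq nat)) : Prop := IsMillerTree {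
  miller_nonempty : exists t, T t;
  miller_tree : forall s t, prefix s t -> T t -> T s;
  miller_increasing : forall t, T t -> sorted ltn t;
  miller_split : forall t, T t -> exists2 s, prefix t s & splitnode T s;
  miller_infinite : forall t, splitnode T t -> infinite_set (successors T t)
}.

Definition miller_condition := {T : set (seq nat) | is_miller_tree T}.

Definition miller_stronger (S T : miller_condition) : Prop :=
  sval S `<=` sval T.

Lemma miller_stronger_refl (T : miller_condition) : miller_stronger T T.
Proof. by []. Qed.

Lemma miller_stronger_trans (S T U : miller_condition) :
  miller_stronger S T -> miller_stronger T U -> miller_stronger S U.
Proof. by move=> ST TU t /ST /TU. Qed.

Definition miller_forcing : forcing_notion :=
  ForcingNotion miller_stronger_refl miller_stronger_trans.

(* Main.v *)
Require Import Defs.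
From mathcomp Require Import all_boot.
From mathcomp Require Import boolp classical_sets cardinality.

Set Implicit Arguments.
Unset Strict Implicit.
Unset Printing Implicit Defensive.

Local Open Scope classical_set_scope.

(** The range x of the Miller real locks all pairs of ground-model sequences.
    Given a condition T and alpha, look at a splitnode r of T.  Each successor
    n of r determines the next splitnode above r^n, and so a bound M on the
    entries met before that splitnode.  As the functions b(beta) are
    increasing, b stays unbounded on the infinite set of successors of r, so
    some beta satisfies c(alpha)(M) <= b(beta)(n) for infinitely many n.  One
    beta serves all of the countably many splitnodes.  Keeping only these
    successors n gives a stronger condition, in which monotonicity of both
    functions yields c(alpha)(m) <= b(beta)(m) for every entry m beyond the
    stem. *)

(** * Infinite sets of naturals and prefixes of sequences *)

Lemma infinite_natP (A : set nat) :
  infinite_set A <-> forall k, exists2 n, k <= n & A n.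
Proof.
split=> [Ainf k | Aunb /finite_seqP[s As]].
  apply: contrapT => noA; apply: Ainf.
  apply: (sub_finite_set _ (finite_II k)) => n An /=.
  by rewrite ltnNge; apply/negP => kn; apply: noA; exists n.
(* No entry of a list exceeds its sum, so a member of [A] above [sumn s] is not listed. *)
have [n sn] := Aunb (sumn s).+1; rewrite As /= => ns.
by move: sn; rewrite (perm_sumn (perm_to_rem ns)) /= ltnNge leq_addr.
Qed.

Lemma leq_sumn_mem (s : seq nat) m : m \in s -> m <= sumn s.
Proof. by move=> ms; rewrite (perm_sumn (perm_to_rem ms)) /= leq_addr. Qed.

Section Prefixes.
Variable T : eqType.
Implicit Types (s t u : seq T) (x y : T).

Lemma prefix_rconsE s t x :
  prefix s (rcons t x) = (s == rcons t x) || prefix s t.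
Proof.
apply/idP/orP => [|[/eqP->|st]]; first last.
- exact: prefix_trans st (prefix_rcons t x).
- exact: prefix_refl.
case/prefixP => u; case/lastP: u => [|u y].
  by rewrite cats0 => ->; left.
by rewrite -rcons_cat => /rcons_inj[-> _]; right; apply: prefix_prefix.
Qed.

Lemma prefix_neqP s t :
  prefix s t -> s != t -> exists x, prefix (rcons s x) t.
Proof.
case/prefixP => -[|x u] ->; first by rewrite cats0 eqxx.
by move=> _; exists x; rewrite -cat_rcons prefix_prefix.
Qed.

Lemma prefix_rcons_inj s t x y :
  prefix (rcons s x) t -> prefix (rcons s y) t -> x = y.
Proof.
move=> /prefixP[u ->] /prefixP[v]; rewrite !cat_rcons => /eqP.
by rewrite eqseq_cat // eqxx /= => /eqP[].
Qed.

Lemma prefix_total s t u : prefix s u -> prefix t u -> prefix s t \/ prefix t s.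
Proof.
elim/last_ind: u => [|u x IH].
  by rewrite !prefixs0 => /eqP-> /eqP->; left.
rewrite !prefix_rconsE => /orP[/eqP->|su] /orP[/eqP->|tu].
- by left; apply: prefix_refl.
- by right; apply: prefix_trans tu (prefix_rcons _ _).
- by left; apply: prefix_trans su (prefix_rcons _ _).
- exact: IH.
Qed.

Lemma mem_prefix_rcons x s : x \in s -> exists t, prefix (rcons t x) s.
Proof.
by case/splitPr => p1 p2; exists p1; rewrite -cat_rcons prefix_prefix.
Qed.

Lemma prefix_mem s t x : prefix s t -> x \in s -> x \in t.
Proof. by case/prefixP => u ->; rewrite mem_cat => ->. Qed.

End Prefixes.

Lemma sorted_prefix_rcons_leq (s t : seq nat) m n : sorted ltn (rcons t n) ->
  prefix (rcons s m) (rcons t n) -> m <= n.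
Proof.
move=> st /prefixP[u]; case/lastP: u => [|u k].
  by rewrite cats0 => /rcons_inj[_ ->].
move=> tE; move: st; rewrite tE cat_rcons sorted_cat_cons => /andP[_].
move/(order_path_min ltn_trans)/allP/(_ k); rewrite mem_rcons mem_head => mk.
move: tE; rewrite -rcons_cat => /rcons_inj[_ ->]; apply: ltnW; exact: mk.
Qed.

(** * Unbounded sequences *)

Section UnboundedSequences.
Variables (W : Type) (lt : W -> W -> Prop).

(** Otherwise countably many countable initial segments would cover [W]. *)
Lemma omega1_countable_bound (hW : is_omega1 lt) (I : countType) (f : I -> W) :
  exists w, forall i, lt (f i) w \/ f i = w.
Proof.
apply: contrapT => nobound; apply: (omega1_uncountable hW).
have -> : [set: W] = \bigcup_i [set w | lt w (f i)].
  apply/seteqP; split => // w _; apply: contrapT => noi; apply: nobound.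
  exists w => i; have [|[|]] := omega1_total hW (f i) w; [by left|by right|].
  by move=> wf; case: noi; exists i.
apply: bigcup_countable => [|i _]; first exact: countableP.
exact: omega1_segments hW _.
Qed.

(** If this fails, let [f] move each [k] up into [Y]. By monotonicity
    [b w m <= b w (f m) <= h (f m)] for large [m], so [h \o f] bounds the whole sequence. *)
Lemma unbounded_sequence_on (b : W -> nat -> nat) (Y : set nat)
    (h : nat -> nat) :
  unbounded_sequence lt b -> infinite_set Y ->
  exists w, infinite_set [set n | Y n /\ h n <= b w n].
Proof.
move=> ub /infinite_natP Yinf; apply: contrapT => nob.
have /choice[f fP] : forall k, exists n, k <= n /\ Y n.
  by move=> k; have [n kn Yn] := Yinf k; exists n.
apply: (unbounded_nobound ub); exists (h \o f) => w.
apply: contrapT => ndom; apply: nob; exists w.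
apply/infinite_natP => k; apply: contrapT => none; apply: ndom.
exists k => m km; have [mf Yf] := fP m.
apply: leq_trans (unbounded_increasing ub w mf) _ => /=.
have [//|/ltnW hb] := leqP (b w (f m)) (h (f m)).
by case: none; exists (f m); [exact: leq_trans mf|].
Qed.

Lemma unbounded_sequence_on_countable (hW : is_omega1 lt) (b : W -> nat -> nat)
    (I : countType) (P : set I) (Y : I -> set nat) (h : I -> nat -> nat) :
  unbounded_sequence lt b -> (forall i, P i -> infinite_set (Y i)) ->
  exists w, forall i, P i -> infinite_set [set n | Y i n /\ h i n <= b w n].
Proof.
move=> ub Yinf.
have /choice[f fP] : forall i, exists w, P i ->
    infinite_set [set n | Y i n /\ h i n <= b w n].
  move=> i; have [Pi|nPi] := pselect (P i).
    by have [w] := unbounded_sequence_on (h i) ub (Yinf i Pi); exists w.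
  (* Outside [P] any element of [W] will do; this application merely supplies one. *)
  by have [w _] := unbounded_sequence_on (h i) ub infinite_nat; exists w.
have [w fw] := omega1_countable_bound hW f; exists w => i Pi.
have [lfw|<-] := fw i; last exact: fP.
(* Passing from [f i] up to [w] loses only the finitely many [n] below [N]. *)
have [N dom] := unbounded_modfin ub lfw.
apply/infinite_natP => k.
have /infinite_natP/(_ (maxn N k))[n] := fP i Pi.
rewrite geq_max => /andP[Nn kn] [Yn hn]; exists n => //; split=> //.
exact: leq_trans hn (dom n Nn).
Qed.

End UnboundedSequences.

(** * Miller trees *)

Lemma splitnode_sub (S T : set (seq nat)) t :
  S `<=` T -> splitnode S t -> splitnode T t.
Proof.
move=> ST [St [m [n [mn Sm Sn]]]]; split; first exact: ST.
by exists m, n; split=> //; exact: ST.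
Qed.

Lemma infinite_splitnode (T : set (seq nat)) t : T t ->
  infinite_set (successors T t) -> splitnode T t.
Proof.
move=> Tt /infinite_natP Tinf; split=> //.
have [m _ Tm] := Tinf 0; have [n mn Tn] := Tinf m.+1.
by exists m, n; split=> // mE; rewrite mE ltnn in mn.
Qed.

Section MillerTrees.
Variables (T : set (seq nat)) (mT : is_miller_tree T).
Implicit Types (s t u : seq nat).

Lemma nonsplitnode_succ t m n : T t -> ~ splitnode T t ->
  T (rcons t m) -> T (rcons t n) -> m = n.
Proof.
move=> Tt nsp Tm Tn; apply: contrapT => mn; apply: nsp.
by split=> //; exists m, n.
Qed.

Lemma miller_long k : exists2 t, T t & k <= size t.
Proof.
elim: k => [|k [t Tt kt]]; first by have [t] := miller_nonempty mT; exists t.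
have [s /size_prefix ts [Ts [m [_ [_ Tm _]]]]] := miller_split mT Tt.
by exists (rcons s m) => //; rewrite size_rcons ltnS (leq_trans kt).
Qed.

Lemma miller_nil : T [::].
Proof.
have [t Tt] := miller_nonempty mT; apply: (miller_tree mT _ Tt).
exact: prefix0s.
Qed.

Definition next_splitnode t s := [/\ prefix t s, splitnode T s &
  forall r, prefix t r -> prefix r s -> splitnode T r -> r = s].

Lemma next_splitnode_ex t : T t -> exists s, next_splitnode t s.
Proof.
move=> Tt.
pose P n := `[< exists s, [/\ prefix t s, splitnode T s & size s = n] >].
have exP : exists n, P n.
  have [s ts sps] := miller_split mT Tt.
  by exists (size s); apply/asboolP; exists s.
case: (ex_minnP exP) => n /asboolP[s [ts sps <-]] smin.
exists s; split=> // r tr rs spr.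
move: rs; rewrite prefixE => /eqP <-; rewrite take_oversize //.
by apply: smin; apply/asboolP; exists r.
Qed.

(* Above a non-splitting node the path to the next splitnode is forced. *)
Lemma miller_between_splitnodes (nxt : seq nat -> seq nat) u :
  (forall t, T t -> next_splitnode t (nxt t)) -> T u ->
  prefix u (nxt [::]) \/
  exists r k, [/\ splitnode T r, prefix (rcons r k) u &
    prefix u (nxt (rcons r k))].
Proof.
move=> nxtP; elim/last_ind: u => [|t n IH] Tu; first by left; apply: prefix0s.
have Tt : T t by apply: (miller_tree mT (prefix_rcons t n) Tu).
have [spt|nspt] := pselect (splitnode T t).
  right; exists t, n; split=> //; first exact: prefix_refl.
  by case: (nxtP _ Tu).
(* As [t] does not split, it differs from the splitnode [nxt v], and the path to [nxt v] must leave
   [t] through its only successor. *)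
have step v : T v -> prefix t (nxt v) -> prefix (rcons t n) (nxt v).
  move=> Tv tv; have [_ spv _] := nxtP v Tv.
  have [k tkv] : exists k, prefix (rcons t k) (nxt v).
    by apply: prefix_neqP tv _; apply/eqP => tE; apply: nspt; rewrite tE.
  suff -> : n = k by [].
  apply: nonsplitnode_succ nspt Tu _ => //.
  by apply: (miller_tree mT tkv _); case: spv.
have [t0|[r [k [spr rkt tnxt]]]] := IH Tt; [left|right].
  exact: step miller_nil t0.
exists r, k; split=> //; first exact: prefix_trans rkt (prefix_rcons _ _).
by apply: step tnxt; apply: (miller_tree mT rkt Tt).
Qed.

(** Only successors of splitnodes are filtered, so a node with a single successor keeps it and no
    path dies before its next splitnode. *)
Definition prune_splitnodes (G : seq nat -> set nat) : set (seq nat) :=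
  [set t | T t /\ forall r n, splitnode T r -> prefix (rcons r n) t -> G r n].

Lemma prune_splitnodes_miller (G : seq nat -> set nat) :
  (forall t, splitnode T t ->
    infinite_set [set n | successors T t n /\ G t n]) ->
  is_miller_tree (prune_splitnodes G).
Proof.
move=> Ginf; have subT : prune_splitnodes G `<=` T by move=> t [].
have succ_inf t : prune_splitnodes G t -> splitnode T t ->
    infinite_set (successors (prune_splitnodes G) t).
  move=> [Tt Gt] spt; apply: sub_infinite_set (Ginf t spt) => n [Tn Gn].
  split=> // r k spr; rewrite prefix_rconsE => /orP[/eqP/rcons_inj[-> ->] //|].
  exact: Gt.
split.
- exists [::]; split=> [|r n _]; first exact: miller_nil.
  by rewrite prefixs0 -size_eq0 size_rcons.
- move=> s t st [Tt Gt]; split=> [|r n spr rs].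
    exact: (miller_tree mT st Tt).
  exact: Gt spr (prefix_trans rs st).
- by move=> t /subT /(miller_increasing mT).
- move=> t [Tt Gt]; have [s [ts sps smin]] := next_splitnode_ex Tt.
  have Ss : prune_splitnodes G s.
    split=> [|r n spr rns]; first by case: sps.
    have [rt|] := prefix_total rns ts; first exact: Gt rt.
    rewrite prefix_rconsE => /orP[/eqP tE|tr].
      by apply: Gt spr _; rewrite tE prefix_refl.
    (* Now [r] would be a splitnode above [t] and strictly below [s], against the minimality of
       [s]. *)
    have rs := prefix_trans (prefix_rcons r n) rns.
    by move/size_prefix: rns; rewrite (smin r) // size_rcons ltnn.
  by exists s => //; apply: infinite_splitnode => //; apply: succ_inf.
- by move=> t spt; apply: succ_inf; [case: spt|exact: splitnode_sub spt].
Qed.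

Definition restrict_tree t : set (seq nat) :=
  [set u | T u /\ (prefix u t \/ prefix t u)].

(** Two successors of a proper initial segment of [t] that are comparable with [t] coincide. Hence
    all splitnodes extend [t], and there no successor is lost. *)
Lemma restrict_tree_miller t : T t -> is_miller_tree (restrict_tree t).
Proof.
move=> Tt; have subT : restrict_tree t `<=` T by move=> u [].
have above u n : prefix t u -> T (rcons u n) -> restrict_tree t (rcons u n).
  move=> tu Tun; split=> //; right.
  exact: prefix_trans tu (prefix_rcons u n).
split.
- by exists t; split=> //; left; apply: prefix_refl.
- move=> s u su [Tu tu]; split; first exact: (miller_tree mT su Tu).
  case: tu => tu; first by left; apply: prefix_trans su tu.
  exact: prefix_total su tu.
- by move=> u /subT /(miller_increasing mT).
- move=> u [Tu ut].
  have [v [Tv tv uv]] : exists v, [/\ T v, prefix t v & prefix u v].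
    by case: ut => ?; [exists t|exists u]; rewrite ?prefix_refl.
  have [s vs [Ts [m [n [mn Tm Tn]]]]] := miller_split mT Tv.
  have ts := prefix_trans tv vs.
  exists s; first exact: prefix_trans uv vs.
  by split; [split=> //; right | exists m, n; split=> //; exact: above].
- move=> u spu; have tu : prefix t u.
    case: spu => -[_ [ut|//]] [m [n [mn [_ um] [_ un]]]].
    apply: contrapT => ntu; apply: mn.
    have below k : prefix (rcons u k) t \/ prefix t (rcons u k) ->
        prefix (rcons u k) t.
      case=> //; rewrite prefix_rconsE => /orP[/eqP->|//].
      exact: prefix_refl.
    exact: prefix_rcons_inj (below m um) (below n un).
  apply: sub_infinite_set (miller_infinite mT (splitnode_sub subT spu)) => n Tn.
  exact: above.
Qed.

End MillerTrees.

Lemma miller_dominating (W : Type) (lt : W -> W -> Prop) (hW : is_omega1 lt)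
    (b c : W -> nat -> nat) (T : set (seq nat)) (a : W) :
  unbounded_sequence lt b -> unbounded_sequence lt c -> is_miller_tree T ->
  exists S a' n0, [/\ is_miller_tree S, S `<=` T &
    forall t m, S t -> m \in t -> n0 <= m -> c a m <= b a' m].
Proof.
move=> ub uc mT.
have /choice[nxt nxtP] : forall t, exists s, T t -> next_splitnode T t s.
  move=> t; have [Tt|nTt] := pselect (T t); last by exists t.
  by have [s] := next_splitnode_ex mT Tt; exists s.
(* The sum serves as the bound on the entries up to the next splitnode. *)
pose h r n := c a (sumn (nxt (rcons r n))).
have [a' hb] := unbounded_sequence_on_countable hW h ub (miller_infinite mT).
exists (prune_splitnodes T (fun r => [set n | h r n <= b a' n])), a'.
exists (sumn (nxt [::])).+1; split; first exact: prune_splitnodes_miller.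
  by move=> t [].
move=> t m [Tt Gt] /mem_prefix_rcons[t' mt] n0m.
(* Cutting [t] right after the entry [m] makes [m] the last entry, hence at least the [k] found
   below. *)
have Tm := miller_tree mT mt Tt.
have mm : m \in rcons t' m by rewrite mem_rcons mem_head.
have [/prefix_mem/(_ mm)/leq_sumn_mem|] := miller_between_splitnodes mT nxtP Tm.
  by rewrite leqNgt n0m.
move=> [r [k [spr rk /prefix_mem/(_ mm)/leq_sumn_mem mnxt]]].
(* The chain is [c a m <= h r k <= b a' k <= b a' m]. *)
apply: leq_trans (unbounded_increasing uc a mnxt) _.
apply: leq_trans (Gt r k spr (prefix_trans rk mt)) _.
apply: unbounded_increasing ub _ _ _ _.
exact: sorted_prefix_rcons_leq (miller_increasing mT Tm) rk.
Qed.

(** * The range of the Miller real *)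

(** A condition is paired with [m] when [m] occurs on all its branches by a fixed level, so that it
    decides that the Miller real takes the value [m]. This avoids a name for the real itself. *)
Definition miller_range : real_name miller_forcing :=
  fun m => [set T : miller_condition |
    exists k, forall t, sval T t -> k <= size t -> m \in t].

(** Some condition below [p] has [m] in all its long nodes, and a Miller tree has nodes of every
    length. *)
Lemma forces_miller_range_mem (p : miller_condition) m :
  @forces miller_forcing p (Member m miller_range) ->
  exists2 t, sval p t & m \in t.
Proof.
move=> /(_ p (@miller_stronger_refl p))[q qp [r [k rk] qr]].
have [t qt kt] := miller_long (svalP q) k.
by exists t; [exact: qp|exact: rk (qr _ qt) kt].
Qed.

Lemma forces_infinite_miller_range (p : miller_forcing) :
  forces p (infinite_formula miller_range).
Proof.
move=> k q _ /=; have mq := svalP q.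
have [s _ sps] := miller_split mq (miller_nil mq).
have /infinite_natP/(_ k)[m km qm] := miller_infinite mq sps.
pose r : miller_forcing := exist _ _ (restrict_tree_miller mq qm).
exists r; first by move=> t [].
exists m; split=> // r' r'r; exists r'; first exact: miller_stronger_refl.
(* This is the length of [rcons s m]; a comparable node at least that long extends it. *)
exists r => //; exists (size s).+1 => t [_ tsm] st.
suff : prefix (rcons s m) t.
  by move=> /prefix_mem; apply; rewrite mem_rcons mem_head.
case: tsm => //; rewrite prefix_rconsE => /orP[/eqP->|/size_prefix].
  exact: prefix_refl.
by rewrite leqNgt st.
Qed.

Lemma forces_dominates_on_miller_range (W : Type) (lt : W -> W -> Prop)
    (hW : is_omega1 lt) (b c : W -> nat -> nat) (p : miller_forcing) :
  unbounded_sequence lt b -> unbounded_sequence lt c ->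
  forces p (All (fun a : W => Ex (fun a' : W =>
    dominates_on_formula miller_range (b a') (c a)))).
Proof.
move=> ub uc a q _.
have [S [a' [n0 [mS Sq dom]]]] := miller_dominating hW a ub uc (svalP q).
pose s : miller_forcing := exist _ S mS.
exists s => //; exists a' => q' q's.
exists q'; first exact: miller_stronger_refl.
(* The inequality concerns the ground model, so a single node containing [m] settles it. *)
exists n0 => m r rq' [n0m /forces_miller_range_mem[t rt mt]].
by apply: dom mt n0m; apply: q's; apply: rq'.
Qed.

Theorem theorem5p6 (W : Type) (lt : W -> W -> Prop) (hW : is_omega1 lt) :
  @notion_forces miller_forcing
    (All (fun b : W -> nat -> nat => All (fun c : W -> nat -> nat =>
      Imp (And (Ground (unbounded_sequence lt b))
               (Ground (unbounded_sequence lt c)))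
          (locked_formula miller_forcing b c)))).
Proof.
move=> p b c q _ [ub uc] r _; exists r; first exact: stronger_refl.
(* The witness depends on neither [b] nor [c], so the two directions of locking are symmetric. *)
exists miller_range; split; first exact: forces_infinite_miller_range.
split; first exact (forces_dominates_on_miller_range hW ub uc).
exact (forces_dominates_on_miller_range hW uc ub).
Qed.
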